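(* Let $p$ be a prime number such that the order of $2$ modulo $p$ is an odd number. Then the group $\mathbb{Z}/p\mathbb{Z}$ does not satisfy the acyclic matching property.
   Context: The order of $2$ modulo $p$ is the multiplicative order of $2$ in $(\mathbb{Z}/p\mathbb{Z})^*$ (so $p \ne 2$ is implicit). Let $G$ be an abelian group, written additively with neutral element $0$. For finite subsets $A, B$ of $G$, a matching from $A$ to $B$ is a bijection $f : A \to B$ such that $a + f(a) \notin A$ for all $a \in A$. Its multiplicity function $m_f : G \to \mathbb{Z}_{\ge 0}$ is $m_f(x) = |\{a \in A : a + f(a) = x\}|$. A matching $f : A \to B$ is acyclic if for every matching $g : A \to B$, $m_f = m_g$ implies $f = g$. The group $G$ has (satisfies) the acyclic matching property if for every pair of finite subsets $A, B$ of $G$ with $|A| = |B|$ and $0 \notin B$, there is at least one acyclic matching from $A$ to $B$. *)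

(* Defs.v *)
From HB Require Import structures.
From mathcomp Require Import all_boot all_order all_fingroup all_algebra.
From mathcomp Require Import finmap.

Set Implicit Arguments.
Unset Strict Implicit.
Unset Printing Implicit Defensive.

Import GRing.Theory.
Local Open Scope ring_scope.

(* [A : {fset G}] coerces to the finite type of its elements, so
   [{ffun A -> B}] is the type of all maps from [A] to [B], with Leibniz
   equality being pointwise equality. *)

Definition is_matching (G : zmodType) (A B : {fset G}) (f : {ffun A -> B}) :
    Prop :=
  bijective f /\ forall a : A, val a + val (f a) \notin A.

Definition multiplicity (G : zmodType) (A B : {fset G}) (f : {ffun A -> B})
    (x : G) : nat :=
  #|[set a : A | val a + val (f a) == x]|.

Definition is_acyclic_matching (G : zmodType) (A B : {fset G})
    (f : {ffun A -> B}) : Prop :=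
  is_matching f /\
  forall g : {ffun A -> B},
    is_matching g -> multiplicity f =1 multiplicity g -> f = g.

Definition acyclic_matching_property (G : zmodType) : Prop :=
  forall A B : {fset G}, #|` A|%fset = #|` B|%fset -> 0 \notin B ->
    exists f : {ffun A -> B}, is_acyclic_matching f.

(* Main.v *)
(** If [A = B], then a matching and its inverse have the same multiplicity
    function, so an acyclic matching [A -> A] is an involution.  Take for [A]
    the subgroup generated by 2: its cardinality is odd, so an involution of
    [A] fixes some [a], and then [a + a = 2 a] lies in [A], a contradiction. *)
Require Import Defs.
From HB Require Import structures.
From mathcomp Require Import all_boot all_order all_fingroup all_algebra.
From mathcomp Require Import finmap.

Import GRing.Theory.
Local Open Scope ring_scope.

(** Without a fixed point every orbit of [f] would have exactly two elements, making [#|T|] twice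
    the number of orbits. *)
Lemma odd_involutive_fixpoint (T : finType) (f : T -> T) :
  involutive f -> odd #|T| -> exists x, f x = x.
Proof.
move=> fK oddT; apply/'exists_eqP.
apply: contraLR oddT => /existsPn nofix.
have order2 x : fingraph.order f x = 2%N.
  have fc : fcycle f [:: x; f x] by rewrite /= fK !eqxx.
  by rewrite (order_cycle fc) ?mem_head //= inE eq_sym nofix.
rewrite -(@fcard_order_set T f (inv_inj fK) 2 predT) ?oddM ?andbF //.
by apply/subsetP => x _; rewrite inE order2.
Qed.

Lemma acyclic_matching_involutive (G : zmodType) (A : {fset G})
    (f : {ffun A -> A}) :
  is_acyclic_matching f -> involutive f.
Proof.
move=> [[[g fK gK] fA] f_uniq]; pose h := [ffun a => g a].
suff fh : f = h by move=> a; rewrite {1}fh ffunE fK.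
apply: f_uniq => [|x].
  split=> [|a]; first by exists f => a; rewrite ffunE ?fK ?gK.
  by rewrite ffunE addrC -{2}[a]gK fA.
(* [f] carries the points where [f] has sum [x] onto those where [g] does: the pairs [(b, f b)] and
   [(f b, b)] have the same sum. *)
rewrite /multiplicity -(card_imset _ (can_inj fK)); apply: eq_card => a.
rewrite !inE ffunE; apply/imsetP/idP => [[b]|ax].
  by rewrite inE => + ->; rewrite fK addrC.
by exists (g a); rewrite ?gK // inE gK addrC.
Qed.

(* [two] is the class of 2 in the unit group of Z/pZ; its existence is what
   forces p <> 2. *)
Theorem proposition2p3 (p : nat) (p_prime : prime p)
  (two : {unit 'F_p}) (twoE : val two = 2%:R)
  (odd_order : odd #[two]%g) :
  ~ acyclic_matching_property 'F_p.
Proof.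
move=> amp; pose A := [fset val u | u in <[two]>%g]%fset.
have A0 : 0 \notin A.
  by apply/imfsetP => -[u _ u0]; move: (valP u); rewrite -u0 unitr0.
have [f facyc] := amp A A erefl A0.
have oddA : odd #|{: A}|.
  by rewrite -cardfE card_imfset -?cardE //; apply: val_inj.
have [a fa] :=
  @odd_involutive_fixpoint _ _ (@acyclic_matching_involutive _ _ _ facyc) oddA.
have [[_ /(_ a)]] := facyc; rewrite fa => /negP[].
have /imfsetP[u /= u2 ->] := valP a.
apply/imfsetP; exists (two * u)%g => /=; first by rewrite groupM ?cycle_id.
by rewrite twoE mulr_natl mulr2n.
Qed.
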